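(* Let $n \ge 7$, let $z$ be a complex number with $|z|\le 1/4$, let $\mathbb{J}$ be the $n\times n$ matrix with all entries on the super-diagonal equal to $1$ and all other entries equal to zero, and let $R$ be an $n\times n$ matrix with each entry uniformly bounded in absolute value by $|z|^n/3$. Then the smallest singular value of $\mathbb{J}+R-zI$ is at least $0.19\,|z|^n$.
   Context: $I$ is the $n\times n$ identity matrix. Matrices have complex entries. *)

(* Defs.v *)
From mathcomp Require Import all_boot all_order all_algebra.
From mathcomp Require Import complex.
From mathcomp Require Import classical_sets reals.
Set Implicit Arguments.
Unset Strict Implicit.
Unset Printing Implicit Defensive.
Import Order.TTheory GRing.Theory Num.Theory.
Local Open Scope ring_scope.
Local Open Scope sesquilinear_scope.
Local Open Scope complex_scope.
Local Open Scope classical_set_scope.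

Definition superdiag_mx (F : pzRingType) (n : nat) : 'M[F]_n :=
  \matrix_(i < n, j < n) ((j : nat) == i.+1)%:R.

Definition singular_value (K : realType) (n : nat) (A : 'M[K[i]]_n) (s : K) : Prop :=
  0 <= s /\ eigenvalue (A^t* *m A) ((s ^+ 2)%:C).

(* For n > 0 this infimum is a minimum: see smallest_singular_valueP. *)
Definition smallest_singular_value (K : realType) (n : nat) (A : 'M[K[i]]_n) : K :=
  inf [set s : K | singular_value A s].

Lemma eigenvalue_gram_ge0 (C : numClosedFieldType) (n : nat) (A : 'M[C]_n) (a : C) :
  eigenvalue (A^t* *m A) a -> 0 <= a.
Proof.
move=> /eigenvalueP[v vA v0].
have h : a * dotmx v v = dotmx (v *m A^t*) (v *m A^t*).
  rewrite !dotmxE trmx_mul map_mxM trmxCK mulmxA -(mulmxA v) vA.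
  by rewrite -scalemxAl [in RHS]mxE.
have vv : 0 < dotmx v v by rewrite dnorm_gt0.
have : 0 <= a * dotmx v v by rewrite h dnorm_ge0.
by rewrite pmulr_lge0.
Qed.

Lemma seq_argmin (T : eqType) (K : realDomainType) (f : T -> K) (r : seq T) :
  (exists a, a \in r) -> exists2 m, m \in r & forall a, a \in r -> f m <= f a.
Proof.
elim: r => [[] //|c r IH _].
case: r IH => [_|d r IH].
  by exists c; rewrite ?mem_head // => a; rewrite inE => /eqP ->.
have [|m mr mP] := IH; first by exists d; rewrite mem_head.
have [le|lt] := leP (f c) (f m).
  exists c; rewrite ?mem_head // => a; rewrite inE => /orP[/eqP -> //|/mP].
  exact: le_trans.
exists m; first by rewrite inE mr orbT.
by move=> a; rewrite inE => /orP[/eqP ->|/mP //]; exact: ltW.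
Qed.

Lemma sqrtRe_sqr (K : realType) (a : K[i]) :
  0 <= a -> ((Num.sqrt (complex.Re a)) ^+ 2)%:C = a.
Proof.
case: a => x y; rewrite lecE => /andP[/eqP /= -> x0].
by rewrite sqr_sqrtr.
Qed.

Lemma smallest_singular_valueP (K : realType) (n : nat) (A : 'M[K[i]]_n) :
  (0 < n)%N ->
  singular_value A (smallest_singular_value A) /\
  forall s : K, singular_value A s -> smallest_singular_value A <= s.
Proof.
move=> n0; set G := A^t* *m A.
have lb0 : lbound [set s : K | singular_value A s] 0 by move=> s [].
split; last by move=> s As; apply: ge_inf => //; exists 0.
have [r rE] := closed_field_poly_normal (char_poly G).
have memr a : (a \in r) = eigenvalue G a.
  rewrite eigenvalue_root_char rE rootZ ?root_prod_XsubC //.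
  by rewrite lead_coef_eq0 monic_neq0 // char_poly_monic.
pose f (a : K[i]) := Num.sqrt (complex.Re a).
have svf a : eigenvalue G a -> singular_value A (f a).
  move=> ea; split; first exact: sqrtr_ge0.
  by rewrite -[f a]/(Num.sqrt (complex.Re a)) sqrtRe_sqr // (eigenvalue_gram_ge0 ea).
have fsv s : singular_value A s -> exists2 a, a \in r & s = f a.
  move=> [s0 es]; exists ((s ^+ 2)%:C); first by rewrite memr.
  by rewrite /f /= sqrtr_sqr ger0_norm.
have [a0 ea0] := eigenvalue_closed G n0.
have [m mr mP] : exists2 m, m \in r & forall a, a \in r -> f m <= f a.
  by apply: seq_argmin; exists a0; rewrite memr.
suff -> : smallest_singular_value A = f m by apply: svf; rewrite -memr.
apply/eqP; rewrite eq_le; apply/andP; split.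
  by apply: ge_inf; [exists 0|apply: svf; rewrite -memr].
apply: lb_le_inf; first by exists (f m); apply: svf; rewrite -memr.
by move=> s /fsv[a ar ->]; exact: mP.
Qed.

(* Main.v *)
(** A least singular vector [v], with singular value [s], satisfies
    [v_(i+1) - z^* v_i = y_i - sum_j v_j (R i j)^*] with [|y_i| <= s |v|_1] (and
    [v_n = 0]).  If [s < 0.19 |z|^n], the right-hand side is at most
    [(0.19 + 1/3) |z|^n |v|_1], so the moduli [|v_i|] are almost a geometric
    progression of ratio [|z| <= 1/4].  Following it from [0] up to [n] forces
    [|v_0| <= c |v|_1] with [c < 3/4], while summing it gives
    [|v|_1 <= 4/3 |v_0| + c n |z|^n |v|_1]; hence [v = 0]. *)
Require Import Defs.
From mathcomp Require Import all_boot all_order all_algebra.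
From mathcomp Require Import complex.
From mathcomp Require Import reals.
From mathcomp Require Import zify ring lra.
Import Order.TTheory GRing.Theory Num.Theory.
Local Open Scope ring_scope.
Local Open Scope complex_scope.

Lemma leq_100n_exp4 (n : nat) : (7 <= n)%N -> (100 * n <= 4 ^ n)%N.
Proof.
elim: n => // n IH; rewrite leq_eqVlt => /orP[/eqP <- //|n7].
by have := IH n7; rewrite expnS; lia.
Qed.

(** The decay of [n / 4 ^ n] makes the error accumulated over [n] coordinates negligible; [7 <= n]
    enters the estimates here. *)
Lemma natr_exp_le (K : realFieldType) (n : nat) (r : K) :
  (7 <= n)%N -> 0 <= r -> r <= 1 / 4 -> n%:R * r ^+ n <= 1 / 100.
Proof.
move=> n7 r0 r4.
have rn : r ^+ n <= (1 / 4) ^+ n by apply: lerXn2r; rewrite ?nnegrE //; lra.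
have n4 : 100 * n%:R <= 4 ^+ n :> K.
  by rewrite -natrX -natrM ler_nat leq_100n_exp4.
have p0 : 0 <= (1 / 4) ^+ n :> K by apply: exprn_ge0; lra.
have p1 : 4 ^+ n * (1 / 4) ^+ n = 1 :> K.
  by rewrite -exprMn mulrC divfK ?expr1n // pnatr_eq0.
have := ler_wpM2l (ler0n K n) rn.
have := ler_wpM2r p0 n4; rewrite p1.
lra.
Qed.

(** The errors pile up to at most [b * (1 + r + r ^+ 2 + ...)], and [4 / 3] is [1 / (1 - r)] at
    [r = 1 / 4]; the induction closes since [r * (4 / 3 * b) + b <= 4 / 3 * b]. *)
Lemma geometric_upper (K : realFieldType) (n : nat) (r b : K) (a : nat -> K) :
  0 <= r -> r <= 1 / 4 -> 0 <= b ->
  (forall i, (i < n)%N -> a i.+1 <= r * a i + b) ->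
  forall i, (i <= n)%N -> a i <= r ^+ i * a 0%N + 4 / 3 * b.
Proof.
move=> r0 r4 b0 a_le; elim=> [_|i IH lin]; first by rewrite expr0; lra.
have := a_le _ lin; have := ler_wpM2l r0 (IH (ltnW lin)).
have := ler_wpM2r b0 r4; rewrite exprS; lra.
Qed.

(** Same error series in the other direction. At [i = n] with [a n = 0] it bounds [r ^+ n * a 0] by
    the error alone. *)
Lemma geometric_lower (K : realFieldType) (n : nat) (r b : K) (a : nat -> K) :
  0 <= r -> r <= 1 / 4 -> 0 <= b ->
  (forall i, (i < n)%N -> r * a i <= a i.+1 + b) ->
  forall i, (i <= n)%N -> r ^+ i * a 0%N <= a i + 4 / 3 * b.
Proof.
move=> r0 r4 b0 a_ge; elim=> [_|i IH lin]; first by rewrite expr0; lra.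
have := a_ge _ lin; have := ler_wpM2l r0 (IH (ltnW lin)).
have := ler_wpM2r b0 r4; rewrite exprS; lra.
Qed.

Lemma geometric_sum_upper (K : realFieldType) (n : nat) (r b : K) (a : nat -> K) :
  0 <= r -> r <= 1 / 4 -> 0 <= b -> 0 <= a 0%N ->
  (forall i, (i < n)%N -> a i.+1 <= r * a i + b) ->
  \sum_(i < n) a i <= 4 / 3 * a 0%N + n%:R * (4 / 3 * b).
Proof.
move=> r0 r4 b0 a0 a_le.
have geo : (\sum_(i < n) r ^+ i) * (1 - r) = 1 - r ^+ n.
  by rewrite mulrC -opprB mulNr -subrX1 opprB.
have geo_le : \sum_(i < n) r ^+ i <= 4 / 3.
  have s0 : 0 <= \sum_(i < n) r ^+ i.
    by apply: sumr_ge0 => i _; exact: exprn_ge0.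
  have := exprn_ge0 n r0; have := ler_wpM2l s0 r4; lra.
have term_le (i : 'I_n) : true -> a i <= r ^+ i * a 0%N + 4 / 3 * b.
  by move=> _; apply: (geometric_upper K n) => //; exact: ltnW.
apply: (le_trans (ler_sum _ term_le)).
rewrite big_split /= -mulr_suml sumr_const card_ord -[X in _ + X]mulr_natl.
by apply: lerD => //; exact: ler_wpM2r.
Qed.

(* [157/300 = 19/100 + 1/3], the constant [c] above is [157/225], and
   [(4/3 + 1/100) * 157/225 < 1]. *)
Lemma almost_geometric_eq0 (K : realFieldType) (n : nat) (r : K) (a : nat -> K) :
  (7 <= n)%N -> 0 < r -> r <= 1 / 4 -> (forall i, 0 <= a i) -> a n = 0 ->
  let X := \sum_(i < n) a i in
  (forall i, (i < n)%N -> a i.+1 <= r * a i + 157 / 300 * (r ^+ n * X)) ->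
  (forall i, (i < n)%N -> r * a i <= a i.+1 + 157 / 300 * (r ^+ n * X)) ->
  X <= 0.
Proof.
move=> n7 r0 r4 a0 an X; set b := 157 / 300 * _ => ub lb.
have X0 : 0 <= X by exact: sumr_ge0.
have q0 : 0 < r ^+ n by exact: exprn_gt0.
have b0 : 0 <= b by have := mulr_ge0 (ltW q0) X0; rewrite /b; lra.
have := geometric_lower _ _ _ _ _ (ltW r0) r4 b0 lb _ (leqnn n).
rewrite an add0r => low.
have up : X <= _ := geometric_sum_upper _ _ _ _ _ (ltW r0) r4 b0 (a0 0%N) ub.
(* Here [157 / 225 = 4 / 3 * (157 / 300)]; the factor [r ^+ n] is common to both sides of [low] and
   cancels because [0 < r]. *)
have a0X : a 0%N <= 157 / 225 * X.
  by rewrite -(ler_pM2l q0); move: low; rewrite /b; lra.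
have := ler_wpM2r X0 (natr_exp_le _ _ _ n7 (ltW r0) r4).
move: up; rewrite /b; lra.
Qed.

Lemma dotmx_sum (C : numClosedFieldType) (n : nat) (u : 'rV[C]_n) :
  dotmx u u = \sum_i `|u 0 i| ^+ 2.
Proof.
by rewrite dotmxE mxE; apply: eq_bigr => i _; rewrite !mxE normCK.
Qed.

(** With [y = v *m A ^t*], the eigenvector equation gives [|y|_2 = t |v|_2]; then [|y_i| <= |y|_2]
    and [|v|_2 <= |v|_1]. *)
Lemma gram_eigenvector_entry_le (C : numClosedFieldType) (n : nat)
    (A : 'M[C]_n) (v : 'rV[C]_n) (t : C) :
  0 <= t -> v *m (A ^t* *m A)%sesqui = t ^+ 2 *: v ->
  forall i, `|(v *m A ^t*%sesqui) 0 i| <= t * \sum_j `|v 0 j|.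
Proof.
move=> t0 vA i; set y := v *m _; set X := \sum_j _.
have X0 : 0 <= X by exact: sumr_ge0.
have dot_y : dotmx y y = t ^+ 2 * dotmx v v.
  rewrite !dotmxE /y trmx_mul map_mxM trmxCK mulmxA -(mulmxA v) vA.
  by rewrite -scalemxAl [in LHS]mxE.
rewrite -ler_sqr ?nnegrE ?mulr_ge0 // exprMn.
apply: (@le_trans _ _ (dotmx y y)).
  rewrite dotmx_sum (bigD1 i) //= lerDl.
  by apply: sumr_ge0 => j _; exact: exprn_ge0.
rewrite dot_y ler_wpM2l ?exprn_ge0 // dotmx_sum expr2 mulr_suml.
apply: ler_sum => j _; rewrite expr2 ler_wpM2l //.
by rewrite /X (bigD1 j) //= lerDl sumr_ge0.
Qed.

(** Extension by zero beyond the last coordinate, so that the last row of the shift obeys the same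
    recursion as the others and the boundary value at [n] is 0. *)
Definition row_ext {C : nmodType} {n : nat} (v : 'rV[C]_n) (i : nat) : C :=
  oapp (v 0) 0 (insub i).

Lemma row_ext_ord (C : nmodType) (n : nat) (v : 'rV[C]_n) (i : 'I_n) :
  row_ext v i = v 0 i.
Proof. by rewrite /row_ext valK. Qed.

Lemma row_ext_n (C : nmodType) (n : nat) (v : 'rV[C]_n) : row_ext v n = 0.
Proof. by rewrite /row_ext insubF // ltnn. Qed.

Lemma mul_row_adjoint_shift (C : numClosedFieldType) (n : nat)
    (R : 'M[C]_n) (z : C) (v : 'rV[C]_n) (i : 'I_n) :
  (v *m (superdiag_mx C n + R - z%:M) ^t*%sesqui) 0 i =
  row_ext v i.+1 - z^* * row_ext v i + \sum_j v 0 j * (R i j)^*.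
Proof.
rewrite mxE.
have -> : \sum_j v 0 j * ((superdiag_mx C n + R - z%:M) ^t*%sesqui) j i =
    \sum_j v 0 j * ((j : nat) == i.+1)%:R
    + (\sum_j v 0 j * (R i j)^* - \sum_j v 0 j * (z^* *+ (i == j))).
  rewrite -sumrB -big_split; apply: eq_bigr => j _ /=.
  rewrite !mxE !raddfD /= raddfN /= !raddfMn /= rmorph1.
  by rewrite mulNrn mulrBr mulrDr addrA.
have -> : \sum_j v 0 j * (z^* *+ (i == j)) = z^* * row_ext v i.
  rewrite row_ext_ord (bigD1 i) //= eqxx mulr1n big1 ?addr0 1?mulrC //.
  by move=> j /negPf ji; rewrite eq_sym ji mulr0n mulr0.
have -> : \sum_j v 0 j * ((j : nat) == i.+1)%:R = row_ext v i.+1.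
  rewrite /row_ext; case: insubP => [k _ kE|ni] /=.
    rewrite (bigD1 k) //= kE eqxx mulr1 big1 ?addr0 //.
    by move=> j; rewrite -kE => /negPf jk; rewrite (inj_eq val_inj) jk mulr0.
  (* Last row: [i.+1] is not an index, so no superdiagonal entry contributes and the extension
     vanishes too. *)
  rewrite big1 // => j _; case: eqP => [ji|_]; last by rewrite mulr0.
  by move: ni; rewrite -ji ltn_ord.
by ring.
Qed.

(** The difference is an entry of [v *m A ^t*], at most [t |v|_1], minus the contribution of [R], at
    most [e |v|_1]. *)
Lemma row_ext_shift_le (C : numClosedFieldType) (n : nat)
    (R : 'M[C]_n) (z t e : C) (v : 'rV[C]_n) :
  let A := superdiag_mx C n + R - z%:M in
  0 <= t -> (forall i j, `|R i j| <= e) ->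
  v *m (A ^t* *m A)%sesqui = t ^+ 2 *: v ->
  forall i, (i < n)%N ->
  `|row_ext v i.+1 - z^* * row_ext v i| <= (t + e) * \sum_j `|v 0 j|.
Proof.
move=> A t0 Re vA i lin; pose k := Ordinal lin.
have := gram_eigenvector_entry_le _ _ _ _ _ t0 vA k.
rewrite mul_row_adjoint_shift /= mulrDl; set d := _ - _; set f := \sum_j _ * _.
move=> dle; rewrite -[d](addrK f); apply: (le_trans (ler_normB _ _)).
apply: lerD => //; apply: (le_trans (ler_norm_sum _ _ _)); rewrite mulr_sumr.
by apply: ler_sum => j _; rewrite normrM norm_conjC mulrC ler_wpM2r.
Qed.

Theorem lemma5p4 (K : realType) (n : nat) (z : K[i]) (R : 'M[K[i]]_n) :
  (7 <= n)%N ->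
  `|z| <= 1 / 4 ->
  (forall i j : 'I_n, `|R i j| <= `|z| ^+ n / 3) ->
  (19 / 100) * `|z| ^+ n
    <= (smallest_singular_value (superdiag_mx K[i] n + R - z%:M))%:C.
Proof.
move=> n7 z4 Rle; have n0 : (0 < n)%N by exact: leq_trans n7.
set A := _ + R - _.
have [[s0 /eigenvalueP[v vA v0]] _] := smallest_singular_valueP A n0.
set s := smallest_singular_value A in s0 vA *.
(* The modulus in [K[i]] is itself an element of [K[i]]; [nrm] brings it down to [K], where the real
   estimates apply. *)
pose nrm (x : K[i]) : K := complex.Re `|x|.
have nrmE x : `|x| = (nrm x)%:C by rewrite /nrm normc_def.
have nrm_ge0 x : 0 <= nrm x by rewrite -lecR -nrmE normr_ge0.
have quarterE : (1 / 4 : K[i]) = (1 / 4)%:C by rewrite rmorphM fmorphV !rmorph_nat.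
have ratioE : (19 / 100 : K[i]) = (19 / 100)%:C.
  by rewrite rmorphM fmorphV !rmorph_nat.
have thirdE : (3^-1 : K[i]) = (3^-1)%:C by rewrite fmorphV rmorph_nat.
rewrite nrmE quarterE lecR in z4.
rewrite nrmE ratioE -rmorphXn -rmorphM lecR.
(* For [z = 0] the claimed bound is 0; otherwise [|z| ^+ n] can be cancelled. *)
have [->|z_neq0] := eqVneq z 0.
  by rewrite /nrm normr0 expr0n gtn_eqF // mulr0.
set r := nrm z in z4 *.
have r0 : 0 < r by rewrite -ltcR -nrmE normr_gt0.
rewrite leNgt; apply/negP => s_lt.
pose a i := nrm (row_ext v i).
pose X := \sum_(i < n) a i.
have X0 : 0 <= X by apply: sumr_ge0 => i _; exact: nrm_ge0.
have XE : \sum_j `|v 0 j| = X%:C.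
  by rewrite rmorph_sum; apply: eq_bigr => j _; rewrite -row_ext_ord nrmE.
have sC : 0 <= s%:C by rewrite lecR.
rewrite rmorphXn in vA.
have step := row_ext_shift_le _ _ _ _ _ _ _ sC Rle vA.
have sX : (s + r ^+ n / 3) * X <= 157 / 300 * (r ^+ n * X).
  by have := ler_wpM2r X0 (ltW s_lt); lra.
have stepK i : (i < n)%N ->
    nrm (row_ext v i.+1 - z^* * row_ext v i) <= 157 / 300 * (r ^+ n * X).
  move=> /step; rewrite XE !nrmE thirdE -rmorphXn -rmorphM -rmorphD -rmorphM lecR.
  by move=> /le_trans; apply.
have zaE i : `|z^* * row_ext v i| = (r * a i)%:C.
  by rewrite normrM norm_conjC !nrmE -rmorphM.
have : X <= 0.
  apply: (almost_geometric_eq0 K n r a) => [|||||i lin|i lin] //.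
  - by move=> i; exact: nrm_ge0.
  - by rewrite /a row_ext_n /nrm normr0.
  (* Both recursions are triangle inequalities for [row_ext v i.+1] and [z^* * row_ext v i], whose
     distance [stepK] bounds. *)
  - apply: le_trans (lerD (lexx _) (stepK i lin)).
    rewrite -lecR rmorphD /= -zaE -!nrmE.
    by apply: le_trans (ler_normD _ _); rewrite subrKC.
  - apply: le_trans (lerD (lexx _) (stepK i lin)).
    rewrite -lecR rmorphD /= -zaE -!nrmE distrC.
    by apply: le_trans (ler_normD _ _); rewrite subrKC.
(* A vanishing sum of moduli would make the eigenvector [v] zero. *)
rewrite leNgt => /negP; apply; rewrite lt0r X0 andbT.
apply: contra v0 => /eqP X_eq0; apply/eqP/rowP => j; rewrite mxE.
have /psumr_eq0P sum0 : \sum_j `|v 0 j| = 0 by rewrite XE X_eq0.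
by apply/eqP; rewrite -normr_eq0; apply/eqP/sum0.
Qed.
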